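(* Let $\mathcal A=\mathbb C[z^{-1},z]]$ and let $\phi\colon H_R\to\mathcal A$ be a character. The following are equivalent: (1) For every $w\in H_R$, $\sum_w\phi(S(w_1))\,|w_2|\,\phi(w_2)\in z^{-1}\mathbb C[[z]]$, i.e. $\phi\circ(S\star Y)$ maps into $z^{-1}\mathbb C[[z]]$. (2) For every $n\ge0$ and $w\in H_R$, $\sum_w\phi(S(w_1))\,|w_2|^n\,\phi(w_2)\in z^{-n}\mathbb C[[z]]$. (3) For every $s\in\mathbb C$ and $w\in H_R$, $\sum_w\phi(S(w_1))\,e^{sz|w_2|}\,\phi(w_2)\in\mathbb C[[z]]$, i.e. $\phi^{\star-1}\star(\phi\circ\theta_{sz})$ maps into $\mathbb C[[z]]$.
   Context: $\mathbb C[z^{-1},z]]$ denotes formal Laurent series in $z$ with finitely many negative powers, $\mathbb C[[z]]$ formal power series. $H_R$ is the Connes–Kreimer Hopf algebra of rooted trees over $\mathbb C$ (basis rooted forests, $|w|$ number of nodes, coproduct $\Delta w=\sum_ww_1\otimes w_2$ determined by $\Delta\circ B_+=B_+\otimes\mathbb 1+(\mathrm{id}\otimes B_+)\circ\Delta$ with $B_+$ grafting onto a new root, antipode $S$). Sums over homogeneous components are understood by linearity. $Y$ is the grading operator $Yw=|w|w$; $\phi\circ\theta_{sz}$ is the character $w\mapsto e^{sz|w|}\phi(w)$ (with $e^{sz|w|}$ expanded as a power series in $z$). A character is a unital algebra morphism; $\phi^{\star-1}=\phi\circ S$. *)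

(* Defs.v *)
From HB Require Import structures.
From mathcomp Require Import all_boot all_order all_algebra.
From Stdlib Require List Permutation.
Set Implicit Arguments. Unset Strict Implicit. Unset Printing Implicit Defensive.
Import Order.TTheory GRing.Theory Num.Theory.
Local Open Scope ring_scope.

(* A rooted tree is represented by a planar representative: a root with an
   (ordered) list of subtrees.  A forest (basis monomial of H_R) is a list of trees; the
   product of H_R is concatenation (commutative, since characters take values
   in a commutative algebra). *)
Inductive tree : Type := Node of seq tree.
Definition forest := seq tree.

Inductive tree_iso : tree -> tree -> Prop :=
  | TIso (ts us vs : seq tree) :
      List.Forall2 tree_iso ts us -> Permutation.Permutation us vs -> tree_iso (Node ts) (Node vs).

Fixpoint tnodes (t : tree) : nat :=
  let: Node ts := t in (sumn (map tnodes ts)).+1.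
Definition fnodes (f : forest) : nat := sumn (map tnodes f).

(* Connes-Kreimer coproduct, as a list of terms  w1 (x) w2  (all coefficients 1),
   determined by  Delta (B+ f) = B+ f (x) 1 + (id (x) B+) (Delta f)
   and multiplicativity. *)
Fixpoint cop (t : tree) : seq (forest * forest) :=
  match t with
  | Node ts =>
      ([:: Node ts], [::]) ::
      [seq (p.1, [:: Node p.2]) | p <-
        (fix copF (us : seq tree) : seq (forest * forest) :=
           match us with
           | [::] => [:: ([::], [::])]
           | u :: us' => [seq (a.1 ++ b.1, a.2 ++ b.2) | a <- cop u, b <- copF us']
           end) ts]
  end.

Fixpoint copF (us : forest) : seq (forest * forest) :=
  match us with
  | [::] => [:: ([::], [::])]
  | u :: us' => [seq (a.1 ++ b.1, a.2 ++ b.2) | a <- cop u, b <- copF us']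
  end.

(* Linear combinations of forests (elements of H_R). *)
Definition lcomb (F : Type) := seq (F * forest).

Section Antipode.
Variable F : numClosedFieldType.

Definition lc_mul (l1 l2 : lcomb F) : lcomb F :=
  [seq (a.1 * b.1, a.2 ++ b.2) | a <- l1, b <- l2].

(* Antipode (with fuel), multiplicative, with
   S(t) = - sum_{(w1,w2) in Delta t, w2 <> 1} S(w1) w2   and S(1) = 1. *)
Fixpoint antipF (n : nat) (f : forest) : lcomb F :=
  match n with
  | 0 => [::]
  | n'.+1 =>
    match f with
    | [::] => [:: (1, [::])]
    | u :: us =>
        lc_mul [seq (- cg.1, cg.2 ++ p.2) | p <- behead (cop u), cg <- antipF n' p.1]
               (antipF n' us)
    end
  end.

(* fuel |f|+1 is sufficient *)
Definition antipode (f : forest) : lcomb F := antipF (fnodes f).+1 f.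

(* (k, a) represents  sum_{n>=0} a n z^(n-k). *)
Definition laurent := (nat * (nat -> F))%type.

Definition lcoef (x : laurent) (j : int) : F :=
  match (j + (x.1)%:Z)%R with Posz m => x.2 m | Negz _ => 0 end.

Definition ps_mul (a b : nat -> F) : nat -> F :=
  fun n => \sum_(i < n.+1) a i * b (n - i)%N.
Definition ps_shift (d : nat) (a : nat -> F) : nat -> F :=
  fun n => if (d <= n)%N then a (n - d)%N else 0.

Definition ls_mul (x y : laurent) : laurent := ((x.1 + y.1)%N, ps_mul x.2 y.2).
Definition ls_add (x y : laurent) : laurent :=
  let k := maxn x.1 y.1 in
  (k, fun n => ps_shift (k - x.1) x.2 n + ps_shift (k - y.1) y.2 n).
Definition ls_scale (c : F) (x : laurent) : laurent := (x.1, fun n => c * x.2 n).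
Definition ls_const (c : F) : laurent := (0%N, fun n => if n == 0%N then c else 0).
Definition ls0 : laurent := ls_const 0.
Definition ls1 : laurent := ls_const 1.
Definition ls_sum (s : seq laurent) : laurent := foldr ls_add ls0 s.
Definition ls_prod (s : seq laurent) : laurent := foldr ls_mul ls1 s.

Definition in_zpow (m : nat) (x : laurent) : Prop :=
  forall j : int, (j < - (m%:Z))%R -> lcoef x j = 0.

Definition ls_exp (c : F) : laurent := (0%N, fun n => c ^+ n / (n`!)%:R).

(* A character of H_R (free commutative algebra on isomorphism classes of
   rooted trees) is given by its values on trees, invariant under isomorphism. *)
Definition is_character (phi : tree -> laurent) : Prop :=
  forall t u, tree_iso t u -> lcoef (phi t) =1 lcoef (phi u).

Definition charF (phi : tree -> laurent) (f : forest) : laurent :=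
  ls_prod (map phi f).
Definition charL (phi : tree -> laurent) (l : lcomb F) : laurent :=
  ls_sum [seq ls_scale x.1 (charF phi x.2) | x <- l].

(* sum_w phi(S(w1)) g(w2) phi(w2), extended linearly to w in H_R *)
Definition convF (phi : tree -> laurent) (g : forest -> laurent) (f : forest) : laurent :=
  ls_sum [seq ls_mul (charL phi (antipode p.1)) (ls_mul (g p.2) (charF phi p.2))
         | p <- copF f].
Definition convL (phi : tree -> laurent) (g : forest -> laurent) (w : lcomb F) : laurent :=
  ls_sum [seq ls_scale x.1 (convF phi g x.2) | x <- w].

End Antipode.

(* Main.v *)
Require Import Defs.
From HB Require Import structures.
From mathcomp Require Import all_boot all_order all_algebra.
From mathcomp Require Import zify ring boolp.
Import Order.TTheory GRing.Theory Num.Theory.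
Local Open Scope ring_scope.
Set Implicit Arguments. Unset Strict Implicit. Unset Printing Implicit Defensive.

(* Equivalence of three pole conditions for a character phi : H_R -> C[z^-1,z]].
   Write chi for phi read in the ring of Laurent series, chi^-1 = chi o S for its
   convolution inverse and Yconj n = chi^-1 * Y^n chi, so that the conditions are
     (1) Yconj 1 in z^-1 C[[z]],  (2) Yconj n in z^-n C[[z]] for all n,
     (3) chi^-1 * (chi o theta_{sz}) in C[[z]] for all s.
   The file has four layers.
   - Laurent series: the frozen representatives (k, a) = z^-k a(z) are made into
     a commutative ring [lseries F] of coefficient functions with finite pole,
     and [pole_le m] (membership in z^-m C[[z]]) is closed under sums, with
     pole orders adding under products.
   - The Connes-Kreimer coproduct is coassociative, counital and graded, so
     convolution of maps forests -> R is associative with unit [eps], Y is a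
     derivation, and a left inverse of a unital map is a right inverse.
   - For any chi : tree -> R, chi o S is a two-sided inverse of chi, and the
     derivation property gives Yconj (n+1) = Yconj 1 * Yconj n + Y (Yconj n),
     whence (1) => (2) by induction on n.
   - The z^j coefficient in (3) is the polynomial sum_i s^i/i! [z^(j-i)] Yconj i
     in s; (2) => (3) is immediate, and (3) => (2) because a polynomial
     vanishing on all of F is zero. *)

(* Laurent series.  A pair (k, a) : laurent F denotes z^-k * a(z); since this
   representation is not unique, everything is stated in terms of the
   coefficient function [lcoef x : int -> F]. *)
Section LaurentCoefficients.
Variable F : numClosedFieldType.
Implicit Types (a b c : nat -> F) (x y z : laurent F).

Lemma lcoefE k a j :
  lcoef (k, a) j = if (0 <= j + k%:Z)%R then a (absz (j + k%:Z)) else 0.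
Proof. by rewrite /lcoef /=; case: (j + k%:Z). Qed.

Lemma lcoef_pad k d a : lcoef ((k + d)%N, ps_shift d a) =1 lcoef (k, a).
Proof.
move=> j; rewrite !lcoefE /ps_shift.
case: ifP => H1; case: ifP => H2 //; try case: ifP => H3 //.
all: try (congr a; lia).
all: lia.
Qed.

Lemma lcoef_eq k a b : a =1 b -> lcoef (k, a) =1 lcoef (k, b).
Proof. by move=> eq_ab j; rewrite !lcoefE eq_ab. Qed.

Lemma lcoef_below x j : (j < - (x.1)%:Z)%R -> lcoef x j = 0.
Proof. by case: x => k a /= Hj; rewrite lcoefE ifF //; lia. Qed.

Lemma lcoef_at x (n : nat) : lcoef x (n%:Z - (x.1)%:Z) = x.2 n.
Proof. by case: x => k a; rewrite lcoefE /= ifT; [congr a; lia | lia]. Qed.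

Lemma lcoef_tabulate (M : nat) (f : int -> F) :
  (forall j, (j < - M%:Z)%R -> f j = 0) ->
  lcoef (M, fun n : nat => f (n%:Z - M%:Z)) =1 f.
Proof.
by move=> f_low j; rewrite lcoefE; case: ifP => Hj; [congr f; lia | rewrite f_low //; lia].
Qed.

Lemma ls_addE x y j : lcoef (ls_add x y) j = lcoef x j + lcoef y j.
Proof.
case: x y => k a [l b].
have E1 := lcoef_pad k (maxn k l - k) a j; have E2 := lcoef_pad l (maxn k l - l) b j.
rewrite subnKC ?leq_maxl // in E1; rewrite subnKC ?leq_maxr // in E2.
by rewrite -E1 -E2 /ls_add /= !lcoefE; case: ifP; rewrite ?addr0.
Qed.

Lemma ls_scaleE (c : F) x j : lcoef (ls_scale c x) j = c * lcoef x j.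
Proof. by case: x => k a; rewrite !lcoefE; case: ifP; rewrite ?mulr0. Qed.

Lemma ls_constE (c : F) j : lcoef (ls_const c) j = if j == 0 then c else 0.
Proof.
rewrite lcoefE addr0 /=; case: (j =P 0) => [->|Hj] //.
by case: ifP => // _; case: ifP => // /eqP; lia.
Qed.

(* Products of power series are computed through truncated polynomials, which
   gives associativity and commutativity of [ps_mul] for free. *)
Definition ps_trunc (n : nat) a : {poly F} := \poly_(i < n.+1) a i.

Lemma ps_mul_poly n a b (p q : {poly F}) :
  (forall i, (i <= n)%N -> p`_i = a i) -> (forall i, (i <= n)%N -> q`_i = b i) ->
  ps_mul a b n = (p * q)`_n.
Proof.
move=> Hp Hq; rewrite coefM /ps_mul; apply: eq_bigr => i _.
by have Hi := ltn_ord i; rewrite Hp ?Hq // ?leq_subr // -ltnS.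
Qed.

Lemma ps_trunc_coef n a i : (i <= n)%N -> (ps_trunc n a)`_i = a i.
Proof. by move=> Hi; rewrite coef_poly ltnS Hi. Qed.

Lemma ps_truncM_coef n a b i : (i <= n)%N -> (ps_trunc n a * ps_trunc n b)`_i = ps_mul a b i.
Proof.
move=> Hi; symmetry; apply: ps_mul_poly => k Hk; apply: ps_trunc_coef; exact: leq_trans Hk Hi.
Qed.

Lemma ps_mulA a b c n : ps_mul (ps_mul a b) c n = ps_mul a (ps_mul b c) n.
Proof.
have tA i : (i <= n)%N -> (ps_trunc n a)`_i = a i by apply: ps_trunc_coef.
have tC i : (i <= n)%N -> (ps_trunc n c)`_i = c i by apply: ps_trunc_coef.
rewrite (ps_mul_poly (p := ps_trunc n a * ps_trunc n b) (q := ps_trunc n c)) //;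
  last exact: ps_truncM_coef.
rewrite (ps_mul_poly (p := ps_trunc n a) (q := ps_trunc n b * ps_trunc n c)) ?mulrA //.
exact: ps_truncM_coef.
Qed.

Lemma ps_mulC a b n : ps_mul a b n = ps_mul b a n.
Proof.
have tr d i : (i <= n)%N -> (ps_trunc n d)`_i = d i by apply: ps_trunc_coef.
by rewrite (ps_mul_poly (tr a) (tr b)) (ps_mul_poly (tr b) (tr a)) mulrC.
Qed.

Lemma ps_mul_shift d a b n : ps_mul (ps_shift d a) b n = ps_shift d (ps_mul a b) n.
Proof.
rewrite (@ps_mul_poly n _ _ ('X^d * ps_trunc n a) (ps_trunc n b)); last first.
- by move=> i Hi; rewrite ps_trunc_coef.
- move=> i Hi; rewrite coefXnM /ps_shift; case: ifP => H; case: ifP => H' //; try lia.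
  by rewrite ps_trunc_coef //; lia.
rewrite -mulrA coefXnM /ps_shift; case: ifP => H; case: ifP => H' //; try lia.
by rewrite (@ps_mul_poly (n - d) _ _ (ps_trunc n a) (ps_trunc n b)) // => *;
  rewrite ps_trunc_coef //; lia.
Qed.

Lemma ps_mulDl a b c n : ps_mul (fun m => a m + b m) c n = ps_mul a c n + ps_mul b c n.
Proof. by rewrite /ps_mul -big_split; apply: eq_bigr => i _; rewrite mulrDl. Qed.

Lemma ps_mul_const (c : F) b n : ps_mul (fun m => if m == 0%N then c else 0) b n = c * b n.
Proof. by rewrite /ps_mul big_ord_recl /= subn0 big1 ?addr0 // => i _; rewrite mul0r. Qed.

Lemma ls_mul_pad x y d :
  lcoef (ls_mul ((x.1 + d)%N, ps_shift d x.2) y) =1 lcoef (ls_mul x y).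
Proof.
case: x y => k a [l b] j; rewrite /ls_mul /= (lcoef_eq _ (ps_mul_shift d a b)).
by rewrite (_ : k + d + l = k + l + d)%N ?lcoef_pad //; lia.
Qed.

Lemma ls_mul_congl x x' y : lcoef x =1 lcoef x' -> lcoef (ls_mul x y) =1 lcoef (ls_mul x' y).
Proof.
move=> eq_x j; set M := maxn x.1 x'.1.
rewrite -(ls_mul_pad x y (M - x.1)) -(ls_mul_pad x' y (M - x'.1)).
rewrite subnKC ?leq_maxl // subnKC ?leq_maxr //.
apply: lcoef_eq => n /=; case: y => l b; apply: eq_bigr => i _; congr (_ * _).
have padE z : (z.1 <= M)%N -> ps_shift (M - z.1) z.2 i = lcoef z (i%:Z - M%:Z).
  case: z => [k a] /= Hz; rewrite -(lcoef_pad k (M - k) a) subnKC // lcoefE ifT; last lia.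
  by congr ps_shift; lia.
by rewrite !padE ?leq_maxl ?leq_maxr.
Qed.

Lemma ls_mulC x y : lcoef (ls_mul x y) =1 lcoef (ls_mul y x).
Proof.
by case: x y => k a [l b]; rewrite /ls_mul /= addnC; apply: lcoef_eq => n; apply: ps_mulC.
Qed.

Lemma ls_mul_congr x y y' : lcoef y =1 lcoef y' -> lcoef (ls_mul x y) =1 lcoef (ls_mul x y').
Proof. by move=> eq_y j; rewrite ls_mulC (ls_mul_congl _ eq_y) ls_mulC. Qed.

Lemma ls_mulA x y z : lcoef (ls_mul (ls_mul x y) z) =1 lcoef (ls_mul x (ls_mul y z)).
Proof.
by case: x y z => k a [l b] [m c]; rewrite /ls_mul /= addnA; apply: lcoef_eq => n; apply: ps_mulA.
Qed.

Lemma ls_mulDl x x' y j :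
  lcoef (ls_mul (ls_add x x') y) j = lcoef (ls_mul x y) j + lcoef (ls_mul x' y) j.
Proof.
have E1 := ls_mul_pad x y (maxn x.1 x'.1 - x.1) j.
have E2 := ls_mul_pad x' y (maxn x.1 x'.1 - x'.1) j.
rewrite subnKC ?leq_maxl // in E1; rewrite subnKC ?leq_maxr // in E2.
rewrite -E1 -E2 {E1 E2}; case: y => l c; rewrite /ls_add /ls_mul /= !lcoefE.
by case: ifP => _; rewrite ?addr0 // ps_mulDl.
Qed.

Lemma ls_mul_const (c : F) y : lcoef (ls_mul (ls_const c) y) =1 lcoef (ls_scale c y).
Proof.
by case: y => l b; rewrite /ls_mul /ls_scale /= add0n; apply: lcoef_eq => n; apply: ps_mul_const.
Qed.

End LaurentCoefficients.

Section LaurentRing.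
Variable F : numClosedFieldType.

Definition finite_pole (f : int -> F) :=
  exists K : nat, forall j, (j < - K%:Z)%R -> f j = 0.

Definition lseries := {f : int -> F | finite_pole f}.
HB.instance Definition _ := gen_eqMixin lseries.
HB.instance Definition _ := gen_choiceMixin lseries.

Definition pole_bound (f : lseries) : nat := projT1 (cid (proj2_sig f)).

Lemma pole_boundP (f : lseries) j : (j < - (pole_bound f)%:Z)%R -> sval f j = 0.
Proof. exact: (projT2 (cid (proj2_sig f))). Qed.

Definition ls_repr (f : lseries) : laurent F :=
  (pole_bound f, fun n : nat => sval f (n%:Z - (pole_bound f)%:Z)).

Lemma lcoef_repr f : lcoef (ls_repr f) =1 sval f.
Proof. exact/lcoef_tabulate/pole_boundP. Qed.

Lemma finite_pole_lcoef (x : laurent F) : finite_pole (lcoef x).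
Proof. by exists x.1 => j; apply: lcoef_below. Qed.

Definition coefs (x : laurent F) : lseries := exist _ (lcoef x) (finite_pole_lcoef x).

Lemma lseries_ext (f g : lseries) : sval f =1 sval g -> f = g.
Proof.
case: f g => f Hf [g Hg] /= /funext eq_fg; subst g.
by congr exist; apply: Prop_irrelevance.
Qed.

Definition ls_zero : lseries := coefs (ls_const 0).
Definition ls_one : lseries := coefs (ls_const 1).
Definition ls_plus (f g : lseries) : lseries := coefs (ls_add (ls_repr f) (ls_repr g)).
Definition ls_opp (f : lseries) : lseries := coefs (ls_scale (-1) (ls_repr f)).
Definition ls_times (f g : lseries) : lseries := coefs (ls_mul (ls_repr f) (ls_repr g)).

Lemma ls_plusE f g j : sval (ls_plus f g) j = sval f j + sval g j.
Proof. by rewrite /= ls_addE !lcoef_repr. Qed.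

Lemma ls_zeroE j : sval ls_zero j = 0.
Proof. by rewrite /= ls_constE; case: ifP. Qed.

Lemma ls_plusA : associative ls_plus.
Proof. by move=> f g h; apply: lseries_ext => j; rewrite !ls_plusE addrA. Qed.
Lemma ls_plusC : commutative ls_plus.
Proof. by move=> f g; apply: lseries_ext => j; rewrite !ls_plusE addrC. Qed.
Lemma ls_plus0 : left_id ls_zero ls_plus.
Proof. by move=> f; apply: lseries_ext => j; rewrite ls_plusE ls_zeroE add0r. Qed.
Lemma ls_plusN : left_inverse ls_zero ls_opp ls_plus.
Proof.
move=> f; apply: lseries_ext => j.
by rewrite ls_plusE ls_zeroE /= ls_scaleE lcoef_repr mulN1r addNr.
Qed.

HB.instance Definition _ := GRing.isZmodule.Build lseries ls_plusA ls_plusC ls_plus0 ls_plusN.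

Lemma ls_timesA : associative ls_times.
Proof.
move=> f g h; apply: lseries_ext => j /=.
rewrite (ls_mul_congl _ (lcoef_repr (ls_times f g))).
by rewrite (ls_mul_congr _ (lcoef_repr (ls_times g h))) ls_mulA.
Qed.
Lemma ls_timesC : commutative ls_times.
Proof. by move=> f g; apply: lseries_ext => j; rewrite /= ls_mulC. Qed.
Lemma ls_times1 : left_id ls_one ls_times.
Proof.
move=> f; apply: lseries_ext => j; rewrite /= (ls_mul_congl _ (lcoef_repr ls_one)) /=.
by rewrite ls_mul_const ls_scaleE mul1r lcoef_repr.
Qed.
Lemma ls_timesDl : left_distributive ls_times ls_plus.
Proof.
move=> f g h; apply: lseries_ext => j; rewrite /= (ls_mul_congl _ (lcoef_repr (ls_plus f g))) /=.
by rewrite ls_mulDl ls_addE !lcoef_repr.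
Qed.
Lemma ls_one_neq0 : ls_one != ls_zero.
Proof.
apply/eqP => /(congr1 (fun f : lseries => sval f 0)).
by rewrite /= !ls_constE eqxx; apply/eqP; rewrite oner_neq0.
Qed.

HB.instance Definition _ :=
  GRing.Zmodule_isComNzRing.Build lseries ls_timesA ls_timesC ls_times1 ls_timesDl ls_one_neq0.

Lemma coefsM x y : coefs (ls_mul x y) = coefs x * coefs y.
Proof.
apply: lseries_ext => j /=.
by rewrite (ls_mul_congl _ (lcoef_repr (coefs x))) (ls_mul_congr _ (lcoef_repr (coefs y))).
Qed.

End LaurentRing.

Section LaurentRingTheory.
Variable F : numClosedFieldType.
Local Notation lseries := (lseries F).
Implicit Types (f g : lseries) (x y : laurent F).

Definition cst (c : F) : lseries := coefs (ls_const c).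

Lemma coefsD x y : coefs (ls_add x y) = coefs x + coefs y.
Proof. by apply: lseries_ext => j; rewrite ls_plusE /= ls_addE. Qed.

Lemma coefs_scale c x : coefs (ls_scale c x) = cst c * coefs x.
Proof. by rewrite /cst -coefsM; apply: lseries_ext => j /=; rewrite ls_mul_const. Qed.

Lemma coefs_sum (s : seq (laurent F)) : coefs (ls_sum s) = \sum_(x <- s) coefs x.
Proof. by elim: s => [|x s IH]; rewrite ?big_nil // big_cons /= coefsD IH. Qed.

Lemma coefs_prod (s : seq (laurent F)) : coefs (ls_prod s) = \prod_(x <- s) coefs x.
Proof. by elim: s => [|x s IH]; rewrite ?big_nil // big_cons /= coefsM IH. Qed.

Lemma cst1 : cst 1 = 1. Proof. by []. Qed.

Lemma cstD a b : cst (a + b) = cst a + cst b.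
Proof. by apply: lseries_ext => j; rewrite ls_plusE /= !ls_constE; case: ifP; rewrite ?addr0. Qed.

Lemma cstM a b : cst (a * b) = cst a * cst b.
Proof.
rewrite -coefs_scale; apply: lseries_ext => j.
by rewrite /= ls_scaleE !ls_constE; case: ifP; rewrite ?mulr0.
Qed.

Lemma cstN a : cst (- a) = - cst a.
Proof. by apply/eqP; rewrite -subr_eq0 opprK -cstD addNr. Qed.

Lemma cst_nat n : cst n%:R = n%:R.
Proof. by elim: n => [|n IH] //; rewrite -addn1 !natrD cstD IH. Qed.

Lemma cstX a n : cst (a ^+ n) = cst a ^+ n.
Proof. by elim: n => [|n IH] //; rewrite !exprS cstM IH. Qed.

Lemma scoef_sum I (s : seq I) (G : I -> lseries) j :
  sval (\sum_(i <- s) G i) j = \sum_(i <- s) sval (G i) j.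
Proof. by elim: s => [|i s IH]; rewrite ?big_nil ?ls_zeroE // !big_cons ls_plusE IH. Qed.

Lemma scoef_cstM c g j : sval (cst c * g) j = c * sval g j.
Proof.
have -> : g = coefs (ls_repr g) by apply: lseries_ext => i; rewrite /= lcoef_repr.
by rewrite -coefs_scale /= ls_scaleE.
Qed.

Definition pole_le (m : nat) f := forall j, (j < - m%:Z)%R -> sval f j = 0.

Lemma pole_le0 m : pole_le m 0.
Proof. by move=> j _; rewrite ls_zeroE. Qed.

Lemma pole_leD m f g : pole_le m f -> pole_le m g -> pole_le m (f + g).
Proof. by move=> Hf Hg j Hj; rewrite ls_plusE Hf ?Hg ?addr0. Qed.

Lemma pole_le_sum m I (s : seq I) (G : I -> lseries) :
  (forall i, pole_le m (G i)) -> pole_le m (\sum_(i <- s) G i).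
Proof. by move=> HG j Hj; rewrite scoef_sum big1 // => i _; apply: HG. Qed.

Lemma pole_le_mono m m' f : (m <= m')%N -> pole_le m f -> pole_le m' f.
Proof. by move=> le_mm' Hf j Hj; apply: Hf; lia. Qed.

Lemma pole_le_of_bound m f : (pole_bound f <= m)%N -> pole_le m f.
Proof. by move=> le_m; apply: pole_le_mono le_m _ => j; apply: pole_boundP. Qed.

Lemma pole_le_repr m f :
  pole_le m f -> lcoef (m, fun n : nat => sval f (n%:Z - m%:Z)) =1 lcoef (ls_repr f).
Proof. by move=> Hf j; rewrite lcoef_tabulate // lcoef_repr. Qed.

Lemma pole_leM a b f g : pole_le a f -> pole_le b g -> pole_le (a + b) (f * g).
Proof.
move=> Hf Hg j Hj; rewrite /= -(ls_mul_congl _ (pole_le_repr Hf)).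
by rewrite -(ls_mul_congr _ (pole_le_repr Hg)) lcoef_below //= -?natrD.
Qed.

Lemma pole_le_cst m c : pole_le m (cst c).
Proof. by move=> j Hj; rewrite /= ls_constE ifF //; apply/eqP; lia. Qed.

Lemma pole_le_cstM m c f : pole_le m f -> pole_le m (cst c * f).
Proof. by move=> Hf; have := pole_leM (@pole_le_cst 0 c) Hf; rewrite add0n. Qed.

Lemma coef_mul_series K e g j : pole_le 0 e -> pole_le K g ->
  sval (e * g) j = if (0 <= j + K%:Z)%R then
     \sum_(i < (absz (j + K%:Z)).+1) sval e i%:Z * sval g (j - i%:Z) else 0.
Proof.
move=> He Hg; rewrite /= -(ls_mul_congl _ (pole_le_repr He)).
rewrite -(ls_mul_congr _ (pole_le_repr Hg)) /ls_mul /= lcoefE add0n.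
by case: ifP => // Hj; apply: eq_bigr => -[i Hi] _ /=; congr (sval e _ * sval g _); lia.
Qed.

End LaurentRingTheory.

Lemma tree_forest_ind (PT : tree -> Prop) (PF : forest -> Prop) :
  PF [::] -> (forall u us, PT u -> PF us -> PF (u :: us)) ->
  (forall ts, PF ts -> PT (Node ts)) -> (forall t, PT t) /\ (forall f, PF f).
Proof.
move=> PF_nil PF_cons PT_node.
have PT_all : forall t, PT t.
  fix IH 1 => -[ts]; apply: PT_node.
  by elim: ts => [|u us IHus] //; apply: PF_cons.
by split=> // f; elim: f => // u us; apply: PF_cons.
Qed.

Lemma copE ts :
  cop (Node ts) = ([:: Node ts], [::]) :: [seq (p.1, [:: Node p.2]) | p <- copF ts].
Proof. by []. Qed.

Lemma copF_nil : copF [::] = [:: ([::], [::])].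
Proof. by []. Qed.

Lemma copF_cons u us :
  copF (u :: us) = [seq (a.1 ++ b.1, a.2 ++ b.2) | a <- cop u, b <- copF us].
Proof. by []. Qed.

Arguments cop : simpl never.
Arguments copF : simpl never.

Lemma fnodes_cat a b : fnodes (a ++ b) = (fnodes a + fnodes b)%N.
Proof. by rewrite /fnodes map_cat sumn_cat. Qed.

Lemma tnodes_gt0 t : (0 < tnodes t)%N.
Proof. by case: t. Qed.

Lemma cop_graded :
  (forall t, all (fun p => fnodes p.1 + fnodes p.2 == tnodes t)%N (cop t)) /\
  (forall f, all (fun p => fnodes p.1 + fnodes p.2 == fnodes f)%N (copF f)).
Proof.
apply: tree_forest_ind => [|u us Hu Hus|ts IH] //.
- rewrite copF_cons; elim: (cop u) Hu => //= a s IHs /andP[/eqP Ha /IHs].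
  rewrite all_cat => ->; rewrite andbT all_map; apply: sub_all Hus => b /eqP Hb /=.
  by rewrite !fnodes_cat addnACA Ha Hb.
- rewrite copE /= all_map; apply/andP; split; first by rewrite /fnodes /= !addn0.
  apply: sub_all IH => p /eqP Hp /=.
  by rewrite /fnodes /= addn0 addnS -/(fnodes p.2) -/(fnodes p.1) Hp.
Qed.

Lemma copF_graded f : all (fun p => fnodes p.1 + fnodes p.2 == fnodes f)%N (copF f).
Proof. by case: cop_graded. Qed.

Lemma cop_proper_lt t : all (fun p => fnodes p.1 < tnodes t)%N (behead (cop t)).
Proof.
case: t => ts; rewrite copE /= all_map; apply: sub_all (copF_graded ts) => p /eqP Hp /=.
by rewrite ltnS -[X in (_ <= X)%N]/(fnodes ts) -Hp leq_addr.
Qed.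

Section CoproductSums.
Variable R : nmodType.

(* Extensionality of sums over sequences of a type without decidable equality. *)
Lemma eq_big_all T (P : pred T) s (G G' : T -> R) : all P s ->
  (forall x, P x -> G x = G' x) -> \sum_(x <- s) G x = \sum_(x <- s) G' x.
Proof.
move=> Ps HG; elim: s Ps => [|x s IH] /=; first by rewrite !big_nil.
by case/andP => Px Ps; rewrite !big_cons HG // IH.
Qed.

Lemma big_copF_cons u us (G : forest * forest -> R) :
  \sum_(p <- copF (u :: us)) G p =
  \sum_(a <- cop u) \sum_(b <- copF us) G (a.1 ++ b.1, a.2 ++ b.2).
Proof. by rewrite copF_cons big_allpairs_dep. Qed.

Lemma big_copF_cat x y (G : forest * forest -> R) :
  \sum_(p <- copF (x ++ y)) G p =
  \sum_(a <- copF x) \sum_(b <- copF y) G (a.1 ++ b.1, a.2 ++ b.2).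
Proof.
elim: x G => [|u x IH] G.
  by rewrite copF_nil big_cons big_nil addr0; apply: eq_bigr => -[].
rewrite cat_cons !big_copF_cons; apply: eq_bigr => a _; rewrite IH.
by apply: eq_bigr => c _; apply: eq_bigr => d _; rewrite /= !catA.
Qed.

Lemma big_copF1 t (G : forest * forest -> R) :
  \sum_(p <- copF [:: t]) G p = \sum_(a <- cop t) G a.
Proof.
rewrite big_copF_cons; apply: eq_bigr => -[a1 a2] _.
by rewrite copF_nil big_cons big_nil addr0 /= !cats0.
Qed.

Lemma coassociativity :
  (forall t (G : forest -> forest -> forest -> R),
    \sum_(p <- cop t) \sum_(q <- copF p.1) G q.1 q.2 p.2 =
    \sum_(p <- cop t) \sum_(q <- copF p.2) G p.1 q.1 q.2) /\
  (forall f (G : forest -> forest -> forest -> R),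
    \sum_(p <- copF f) \sum_(q <- copF p.1) G q.1 q.2 p.2 =
    \sum_(p <- copF f) \sum_(q <- copF p.2) G p.1 q.1 q.2).
Proof.
apply: tree_forest_ind.
- by move=> G; rewrite copF_nil !big_cons !big_nil /=.
- move=> u us Hu Hus G; rewrite !big_copF_cons.
  transitivity (\sum_(a <- cop u) \sum_(c <- copF a.1) \sum_(b <- copF us)
      \sum_(d <- copF b.1) G (c.1 ++ d.1) (c.2 ++ d.2) (a.2 ++ b.2)).
    by apply: eq_bigr => a _; under eq_bigr => b _ do rewrite big_copF_cat; rewrite exchange_big.
  rewrite (Hu (fun x y z => \sum_(b <- copF us) \sum_(d <- copF b.1)
                              G (x ++ d.1) (y ++ d.2) (z ++ b.2))).
  apply: eq_bigr => a _ /=.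
  under eq_bigr => c _ do rewrite (Hus (fun x y z => G (a.1 ++ x) (c.1 ++ y) (c.2 ++ z))) /=.
  by rewrite exchange_big; apply: eq_bigr => b _ /=; rewrite big_copF_cat.
- move=> ts IH G.
  have -> : \sum_(p <- cop (Node ts)) \sum_(q <- copF p.1) G q.1 q.2 p.2 =
      G [:: Node ts] [::] [::] + \sum_(p <- copF ts) G p.1 [:: Node p.2] [::] +
      \sum_(p <- copF ts) \sum_(q <- copF p.1) G q.1 q.2 [:: Node p.2].
    by rewrite copE big_cons big_map big_copF1 copE big_cons big_map.
  have -> : \sum_(p <- cop (Node ts)) \sum_(q <- copF p.2) G p.1 q.1 q.2 =
      G [:: Node ts] [::] [::] + (\sum_(p <- copF ts) G p.1 [:: Node p.2] [::] +
      \sum_(p <- copF ts) \sum_(q <- copF p.2) G p.1 q.1 [:: Node q.2]).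
    rewrite copE big_cons big_map copF_nil big_cons big_nil addr0 -big_split.
    by congr (_ + _); apply: eq_bigr => p _; rewrite big_copF1 copE big_cons big_map.
  by rewrite -addrA (IH (fun x y z => G x y [:: Node z])).
Qed.

Lemma counit_left :
  (forall t (H : forest -> R),
     \sum_(a <- cop t) (if a.1 is [::] then H a.2 else 0) = H [:: t]) /\
  (forall f (H : forest -> R),
     \sum_(p <- copF f) (if p.1 is [::] then H p.2 else 0) = H f).
Proof.
apply: tree_forest_ind.
- by move=> H; rewrite copF_nil big_cons big_nil addr0.
- move=> u us Hu Hus H; rewrite big_copF_cons -(Hu (fun z => H (z ++ us))).
  apply: eq_bigr => -[[|x a1] a2] _ /=; first exact: (Hus (fun z => H (a2 ++ z))).
  by rewrite big1.
- by move=> ts IH H; rewrite copE big_cons big_map /= add0r (IH (fun z => H [:: Node z])).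
Qed.

Lemma counit_right :
  (forall t (H : forest -> R),
     \sum_(a <- cop t) (if a.2 is [::] then H a.1 else 0) = H [:: t]) /\
  (forall f (H : forest -> R),
     \sum_(p <- copF f) (if p.2 is [::] then H p.1 else 0) = H f).
Proof.
apply: tree_forest_ind.
- by move=> H; rewrite copF_nil big_cons big_nil addr0.
- move=> u us Hu Hus H; rewrite big_copF_cons -(Hu (fun z => H (z ++ us))).
  apply: eq_bigr => -[a1 [|x a2]] _ /=; first exact: (Hus (fun z => H (a1 ++ z))).
  by rewrite big1.
- by move=> ts IH H; rewrite copE big_cons big_map /= big1 ?addr0.
Qed.

End CoproductSums.

Lemma fnodes_cons_gt0 x f : (0 < fnodes (x :: f))%N.
Proof. by rewrite /fnodes /= -/(fnodes f); have := tnodes_gt0 x; lia. Qed.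

(* The convolution algebra of linear maps H_R -> R, for a commutative ring R;
   such maps are determined by their values on forests. *)
Section Convolution.
Variable R : comNzRingType.
Implicit Types (a b c : forest -> R).

Definition conv a b f : R := \sum_(p <- copF f) a p.1 * b p.2.

Definition eps (f : forest) : R := if f is [::] then 1 else 0.

Definition grade a f : R := (fnodes f)%:R * a f.

Lemma eq_conv a a' b b' : a =1 a' -> b =1 b' -> conv a b =1 conv a' b'.
Proof. by move=> Ea Eb f; apply: eq_bigr => p _; rewrite Ea Eb. Qed.

Lemma conv_assoc a b c f : conv (conv a b) c f = conv a (conv b c) f.
Proof.
rewrite /conv; under eq_bigr => p _ do rewrite big_distrl /=.
rewrite ((coassociativity R).2 f (fun x y z => a x * b y * c z)).
by apply: eq_bigr => p _; rewrite big_distrr; apply: eq_bigr => q _; rewrite /= mulrA.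
Qed.

Lemma conv1l b f : conv eps b f = b f.
Proof.
rewrite /conv -((counit_left R).2 f b).
by apply: eq_bigr => -[[|x p1] p2] _ /=; rewrite ?mul1r ?mul0r.
Qed.

Lemma conv1r a f : conv a eps f = a f.
Proof.
rewrite /conv -((counit_right R).2 f a).
by apply: eq_bigr => -[p1 [|x p2]] _ /=; rewrite ?mulr1 ?mulr0.
Qed.

Lemma convDr a b b' f : conv a (fun g => b g + b' g) f = conv a b f + conv a b' f.
Proof. by rewrite /conv -big_split; apply: eq_bigr => p _; rewrite mulrDr. Qed.

(* Since the coproduct is graded, Y is a derivation of the convolution. *)
Lemma grade_conv a b f : grade (conv a b) f = conv (grade a) b f + conv a (grade b) f.
Proof.
rewrite /grade /conv big_distrr -big_split.
apply: (eq_big_all (copF_graded f)) => p /eqP Hp /=.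
by rewrite -Hp natrD /=; ring.
Qed.

Lemma conv_split a c f : conv a c f =
  a [::] * c f + \sum_(p <- copF f) (if p.1 is [::] then 0 else a p.1 * c p.2).
Proof.
rewrite /conv -[X in X + _]((counit_left R).2 f (fun z => a [::] * c z)) -big_split.
by apply: eq_bigr => -[[|x p1] p2] _ /=; rewrite ?addr0 ?add0r.
Qed.

Lemma conv_right_inverse a b : a [::] = 1 ->
  (forall f, conv a b f = eps f) -> forall f, conv b a f = eps f.
Proof.
move=> a_nil ab_eps f; move: {2}(fnodes f).+1 (ltnSn (fnodes f)) => n.
elim: n f => // n IH f lt_f_n.
set S := \sum_(p <- copF f) (if p.1 is [::] then 0 else a p.1 * eps p.2).
have E1 : a f = conv b a f + S.
  rewrite -{1}(conv1l a f) -(eq_conv ab_eps (frefl a)) conv_assoc conv_split a_nil mul1r.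
  congr (_ + _); apply: (eq_big_all (copF_graded f)) => -[[|x p1] p2] //= /eqP Hp.
  by rewrite IH //; have := fnodes_cons_gt0 x p1; lia.
have E2 : a f = eps f + S by rewrite -{1}(conv1r a f) conv_split a_nil mul1r.
by apply: (addIr S); rewrite -E1 -E2.
Qed.

End Convolution.

Section CharacterInverse.
Variable R : comNzRingType.
Variable chi : tree -> R.

Definition chiF (f : forest) : R := \prod_(t <- f) chi t.

Lemma chiF_cat f g : chiF (f ++ g) = chiF f * chiF g.
Proof. by rewrite /chiF big_cat. Qed.

(* chi o S, computed with fuel n by the recursion that defines [antipF]:
   (chi o S)(u us) = - (sum_{Delta u, w1 <> u} (chi o S)(w1) chi(w2)) (chi o S)(us). *)
Fixpoint chiS_fuel (n : nat) (f : forest) : R :=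
  match n, f with
  | 0, _ => 0
  | n'.+1, [::] => 1
  | n'.+1, u :: us =>
      (- \sum_(p <- behead (cop u)) chiS_fuel n' p.1 * chiF p.2) * chiS_fuel n' us
  end.

Definition chiS (f : forest) : R := chiS_fuel (fnodes f).+1 f.

Lemma chiS_fuel_enough n m f :
  (fnodes f < n)%N -> (fnodes f < m)%N -> chiS_fuel n f = chiS_fuel m f.
Proof.
elim: n m f => [|n IH] [|m] [|u us] //= lt_n lt_m.
have u_gt0 := tnodes_gt0 u; have Eus : fnodes (u :: us) = (tnodes u + fnodes us)%N by [].
rewrite Eus in lt_n lt_m; congr (- _ * _); last by apply: IH; lia.
apply: (eq_big_all (cop_proper_lt u)) => p lt_p; congr (_ * _); apply: IH; lia.
Qed.

Lemma chiS_nil : chiS [::] = 1.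
Proof. by []. Qed.

Lemma chiS_cons u us :
  chiS (u :: us) = (- \sum_(p <- behead (cop u)) chiS p.1 * chiF p.2) * chiS us.
Proof.
have u_gt0 := tnodes_gt0 u; have Eus : fnodes (u :: us) = (tnodes u + fnodes us)%N by [].
rewrite /chiS Eus [LHS]/=; congr (- _ * _); last by apply: chiS_fuel_enough; lia.
apply: (eq_big_all (cop_proper_lt u)) => p lt_p; congr (_ * _).
by apply: chiS_fuel_enough; lia.
Qed.

Lemma chiS_cat f g : chiS (f ++ g) = chiS f * chiS g.
Proof. by elim: f => [|u f IH]; rewrite ?chiS_nil ?mul1r // cat_cons !chiS_cons IH mulrA. Qed.

(* chi o S is a left inverse of chi: the convolution of two characters is
   multiplicative on forests, and on a single tree it vanishes by the very
   recursion defining chi o S. *)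
Lemma chiS_conv_chi f : conv chiS chiF f = eps R f.
Proof.
case: f => [|u us].
  by rewrite /conv copF_nil big_cons big_nil addr0 chiS_nil /chiF big_nil mul1r.
rewrite /conv big_copF_cons /=.
transitivity ((\sum_(a <- cop u) chiS a.1 * chiF a.2) *
              (\sum_(b <- copF us) chiS b.1 * chiF b.2)).
  rewrite big_distrlr; apply: eq_bigr => a _; apply: eq_bigr => b _ /=.
  by rewrite chiS_cat chiF_cat mulrACA.
suff -> : \sum_(a <- cop u) chiS a.1 * chiF a.2 = 0 by rewrite mul0r.
have Eu : chiS [:: u] = - \sum_(p <- behead (cop u)) chiS p.1 * chiF p.2.
  by rewrite chiS_cons chiS_nil mulr1.
case: u Eu => ts Eu; rewrite copE big_cons /= /chiF big_nil mulr1 Eu.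
by rewrite copE /= addNr.
Qed.

Lemma chi_conv_chiS f : conv chiF chiS f = eps R f.
Proof. exact: conv_right_inverse chiS_nil chiS_conv_chi f. Qed.

Definition Ychi (n : nat) (f : forest) : R := (fnodes f)%:R ^+ n * chiF f.
Definition Yconj (n : nat) (f : forest) : R := conv chiS (Ychi n) f.

Lemma Ychi_conv n f : Ychi n f = conv chiF (Yconj n) f.
Proof.
rewrite /Yconj -conv_assoc (eq_conv (b' := Ychi n) chi_conv_chiS) //.
by rewrite conv1l.
Qed.

Lemma Yconj0 f : Yconj 0 f = eps R f.
Proof. by rewrite -chiS_conv_chi; apply: eq_conv => // g; rewrite /Ychi mul1r. Qed.

(* Y (chi * Yconj n) = Y chi * Yconj n + chi * Y (Yconj n) yields the recursion
   Yconj (n+1) = Yconj 1 * Yconj n + Y (Yconj n). *)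
Lemma Yconj_succ n f : Yconj n.+1 f = conv (Yconj 1) (Yconj n) f + grade (Yconj n) f.
Proof.
have YchiS g : Ychi n.+1 g = conv (Ychi 1) (Yconj n) g + conv chiF (grade (Yconj n)) g.
  have -> : Ychi n.+1 g = grade (conv chiF (Yconj n)) g.
    by rewrite /grade -Ychi_conv /Ychi exprS mulrA.
  by rewrite grade_conv; congr (_ + _); apply: eq_conv => // h; rewrite /grade /Ychi expr1.
rewrite /Yconj (eq_conv (frefl chiS) YchiS) convDr -!conv_assoc; congr (_ + _).
by rewrite (eq_conv (b' := grade (Yconj n)) chiS_conv_chi) // conv1l.
Qed.

End CharacterInverse.

Section Translation.
Variable F : numClosedFieldType.
Variable phi : tree -> laurent F.
Local Notation lseries := (lseries F).

Definition Phi (t : tree) : lseries := coefs (phi t).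

Definition on_comb (l : lcomb F) : lseries := \sum_(x <- l) cst x.1 * chiF Phi x.2.

Lemma coefs_charF f : coefs (charF phi f) = chiF Phi f.
Proof. by rewrite /charF coefs_prod big_map. Qed.

Lemma coefs_charL l : coefs (charL phi l) = on_comb l.
Proof.
rewrite /charL coefs_sum big_map; apply: eq_bigr => x _.
by rewrite coefs_scale coefs_charF.
Qed.

Lemma on_comb_mul l1 l2 : on_comb (lc_mul l1 l2) = on_comb l1 * on_comb l2.
Proof.
rewrite /on_comb /lc_mul big_allpairs_dep big_distrlr; apply: eq_bigr => a _.
by apply: eq_bigr => b _ /=; rewrite cstM chiF_cat mulrACA.
Qed.

Lemma on_comb_antipF n f : on_comb (antipF F n f) = chiS_fuel Phi n f.
Proof.
elim: n f => [|n IH] [|u us] /=; try by rewrite /on_comb big_nil.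
  by rewrite /on_comb big_cons big_nil addr0 cst1 mul1r /chiF big_nil.
rewrite on_comb_mul IH; congr (_ * _).
rewrite /on_comb big_allpairs_dep -sumrN; apply: eq_bigr => p _.
rewrite -IH /on_comb big_distrl -sumrN; apply: eq_bigr => cg _ /=.
by rewrite cstN chiF_cat mulNr mulrA.
Qed.

Lemma coefs_convF g f :
  coefs (convF phi g f) = conv (chiS Phi) (fun h => coefs (g h) * chiF Phi h) f.
Proof.
rewrite /convF coefs_sum big_map; apply: eq_bigr => p _.
by rewrite !coefsM coefs_charL coefs_charF on_comb_antipF.
Qed.

Lemma coefs_convF_pow n f :
  coefs (convF phi (fun h => ls_const ((fnodes h)%:R ^+ n)) f) = Yconj Phi n f.
Proof. by rewrite coefs_convF; apply: eq_conv => // h; rewrite -/(cst _) cstX cst_nat. Qed.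

Definition Eseries (s : F) (f : forest) : lseries :=
  coefs (convF phi (fun h => ls_exp (s * (fnodes h)%:R)) f).

Lemma in_zpow_convL m g :
  (forall w, in_zpow m (convL phi g w)) <-> (forall f, pole_le m (coefs (convF phi g f))).
Proof.
have coefsE w : in_zpow m (convL phi g w) <-> pole_le m (coefs (convL phi g w)) by [].
have convLE w : coefs (convL phi g w) = \sum_(x <- w) cst x.1 * coefs (convF phi g x.2).
  by rewrite /convL coefs_sum big_map; apply: eq_bigr => x _; rewrite coefs_scale.
split=> H.
  move=> f; have /coefsE := H [:: (1, f)].
  by rewrite convLE big_cons big_nil addr0 cst1 mul1r.
move=> w; apply/coefsE; rewrite convLE; apply: pole_le_sum => x; exact: pole_le_cstM.
Qed.

Lemma in_zpow_powers n :
  (forall w, in_zpow n (convL phi (fun f => ls_const ((fnodes f)%:R ^+ n)) w)) <->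
  (forall f, pole_le n (Yconj Phi n f)).
Proof. by rewrite in_zpow_convL; split=> H f; move: (H f); rewrite coefs_convF_pow. Qed.

Lemma in_zpow_exps :
  (forall s w, in_zpow 0 (convL phi (fun f => ls_exp (s * (fnodes f)%:R)) w)) <->
  (forall s f, pole_le 0 (Eseries s f)).
Proof. by split=> H s; apply/in_zpow_convL; apply: H. Qed.

End Translation.

(* A polynomial over a numeric domain (characteristic zero) vanishing
   everywhere is zero, having more roots than its size. *)
Lemma poly_vanishing_eq0 (R : numDomainType) (p : {poly R}) : (forall x, p.[x] = 0) -> p = 0.
Proof.
move=> p0; apply: (@roots_geq_poly_eq0 _ p [seq i%:R | i <- iota 0 (size p)]).
- by apply/allP => y /mapP[i _ ->]; rewrite /root p0.
- by rewrite map_inj_uniq ?iota_uniq // => a b /eqP; rewrite eqr_nat => /eqP.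
- by rewrite size_map size_iota.
Qed.

Lemma all_le_bigmax T (G : T -> nat) (s : seq T) :
  all (fun x => G x <= \max_(y <- s) G y)%N s.
Proof.
elim: s => [|x s IH] //=; rewrite big_cons leq_maxl /=.
by apply: sub_all IH => y le_y; rewrite (leq_trans le_y) // leq_maxr.
Qed.

Section PoleOrders.
Variable F : numClosedFieldType.
Variable phi : tree -> laurent F.
Local Notation lseries := (lseries F).
Local Notation Yconj := (Yconj (Phi phi)).
Local Notation Eseries := (Eseries phi).

Lemma Yconj_pole_le :
  (forall f, pole_le 1 (Yconj 1 f)) -> forall n f, pole_le n (Yconj n f).
Proof.
move=> H1; elim=> [|n IH] f.
  by rewrite Yconj0; case: f => [|x f]; [apply: (@pole_le_cst _ 0 1) | apply: pole_le0].
rewrite Yconj_succ; apply: pole_leD.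
  by rewrite -add1n; apply: pole_le_sum => p; apply: pole_leM.
by rewrite /grade -cst_nat; apply/pole_le_cstM/(pole_le_mono (leqnSn n)).
Qed.

(* The terms chi^-1(w1) chi(w2) of Delta f, and a common bound for their pole
   orders, which then bounds the pole order of every Yconj n f. *)
Definition term (p : forest * forest) : lseries := chiS (Phi phi) p.1 * chiF (Phi phi) p.2.
Definition term_pole (f : forest) : nat := \max_(p <- copF f) pole_bound (term p).

Lemma pole_le_term f : all (fun p => pole_bound (term p) <= term_pole f)%N (copF f).
Proof. exact: all_le_bigmax. Qed.

Lemma coef_Yconj n f k :
  sval (Yconj n f) k = \sum_(p <- copF f) (fnodes p.2)%:R ^+ n * sval (term p) k.
Proof.
rewrite /Yconj /conv scoef_sum; apply: eq_bigr => p _.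
by rewrite /Ychi -cst_nat -cstX mulrCA scoef_cstM.
Qed.

Lemma pole_le_Yconj n f : pole_le (term_pole f) (Yconj n f).
Proof.
move=> k Hk; rewrite coef_Yconj (eq_big_all (pole_le_term f) (G' := fun _ => 0)) ?big1 //.
by move=> p /pole_le_of_bound Hp; rewrite Hp ?mulr0.
Qed.

Definition expo (c : F) : lseries := coefs (ls_exp c).

Lemma pole_le_expo c : pole_le 0 (expo c).
Proof. by move=> j Hj; rewrite /= lcoef_below. Qed.

Lemma coef_expo c (i : nat) : sval (expo c) i%:Z = c ^+ i / (i`!)%:R.
Proof. by have := lcoef_at (ls_exp c) i; rewrite /= subr0. Qed.

Lemma coef_Eseries s f j : sval (Eseries s f) j =
  if (0 <= j + (term_pole f)%:Z)%R then
    \sum_(i < (absz (j + (term_pole f)%:Z)).+1) s ^+ i / (i`!)%:R * sval (Yconj i f) (j - i%:Z)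
  else 0.
Proof.
set K := term_pole f; set N := absz (j + K%:Z).
rewrite /Eseries coefs_convF /conv scoef_sum.
rewrite (eq_big_all (pole_le_term f) (G' := fun p => if (0 <= j + K%:Z)%R then
    \sum_(i < N.+1) sval (expo (s * (fnodes p.2)%:R)) i%:Z * sval (term p) (j - i%:Z)
  else 0)); last first.
  move=> p /pole_le_of_bound Hp.
  by rewrite mulrCA -/(expo _) (coef_mul_series _ (pole_le_expo _) Hp).
case: ifP => _; last by rewrite big1.
rewrite exchange_big; apply: eq_bigr => i _.
rewrite coef_Yconj big_distrr; apply: eq_bigr => p _.
by rewrite coef_expo exprMn /=; ring.
Qed.

Lemma Eseries_pole_le :
  (forall n f, pole_le n (Yconj n f)) -> forall s f, pole_le 0 (Eseries s f).
Proof.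
move=> H s f j Hj; rewrite coef_Eseries; case: ifP => // _.
by apply: big1 => -[i Hi] _ /=; rewrite H ?mulr0 //; lia.
Qed.

(* (3) => (2): the z^{k+n} coefficient of Eseries s f vanishes for every s,
   so its s^n coefficient [z^k](Yconj n f) / n! vanishes. *)
Lemma Yconj_pole_le_of_Eseries :
  (forall s f, pole_le 0 (Eseries s f)) -> forall n f, pole_le n (Yconj n f).
Proof.
move=> H n f k Hk.
have [lt_kK|le_Kk] := ltP k (- (term_pole f)%:Z); first exact: pole_le_Yconj.
set j := k + n%:Z; set N := absz (j + (term_pole f)%:Z).
have le_nN : (n <= N)%N by rewrite /N /j; lia.
pose P : {poly F} := \poly_(i < N.+1) (sval (Yconj i f) (j - i%:Z) / (i`!)%:R).
have P0 : P = 0.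
  apply: poly_vanishing_eq0 => x; rewrite horner_poly.
  transitivity (sval (Eseries x f) j); last by apply: H; rewrite /j; lia.
  by rewrite coef_Eseries ifT; [apply: eq_bigr => i _; ring | rewrite /j; lia].
have /eqP := congr1 (fun q : {poly F} => q`_n) P0.
rewrite coef_poly coef0 ltnS le_nN mulf_eq0 invr_eq0 pnatr_eq0.
rewrite -[(_ == 0)%N]negbK -lt0n fact_gt0 orbF.
by rewrite (_ : j - n%:Z = k) //; [move/eqP | rewrite /j; lia].
Qed.

End PoleOrders.

Theorem mainTheorem16 (F : numClosedFieldType) (phi : tree -> laurent F)
  (Hphi : is_character phi) :
  ((forall w : lcomb F,
      in_zpow 1 (convL phi (fun f => ls_const ((fnodes f)%:R : F)) w)) <->
   (forall (n : nat) (w : lcomb F),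
      in_zpow n (convL phi (fun f => ls_const ((fnodes f)%:R ^+ n : F)) w)))
  /\
  ((forall (n : nat) (w : lcomb F),
      in_zpow n (convL phi (fun f => ls_const ((fnodes f)%:R ^+ n : F)) w)) <->
   (forall (s : F) (w : lcomb F),
      in_zpow 0 (convL phi (fun f => ls_exp (s * (fnodes f)%:R)) w))).
Proof.
have pow1 : (fun f => ls_const ((fnodes f)%:R : F)) = (fun f => ls_const ((fnodes f)%:R ^+ 1)).
  by apply: funext => f; rewrite expr1.
have powers : (forall n w, in_zpow n (convL phi (fun f => ls_const ((fnodes f)%:R ^+ n : F)) w))
          <-> (forall n f, pole_le n (Yconj (Phi phi) n f)).
  by split=> H n; apply/in_zpow_powers; apply: H.
rewrite pow1 (in_zpow_powers phi 1) powers in_zpow_exps.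
split; split.
- exact: Yconj_pole_le.
- by move=> H; apply: H.
- exact: Eseries_pole_le.
- exact: Yconj_pole_le_of_Eseries.
Qed.
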